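(* Let $T\subseteq\Pi_n$ be a lower set that is invariant under the action of the symmetric group, that is, if $\pi=(F_1,\dots,F_\ell)\in T$, then for any bijection $\tau:\{1,\dots,n\}\to\{1,\dots,n\}$ the permuted partition $\tau(\pi)=(\tau(F_1),\dots,\tau(F_\ell))$ is also an element of $T$. Then there exists a lower set $S\subseteq\operatorname{Par}(n)$ such that, for $\pi\in\Pi_n$, $\pi\in T$ if and only if $\operatorname{sh}(\pi)\in S$. Conversely, for every lower set $S\subseteq\operatorname{Par}(n)$, the set $\{\pi\in\Pi_n:\operatorname{sh}(\pi)\in S\}$ is a lower set of $\Pi_n$ invariant under the action of the symmetric group. Furthermore, the M\''obius function $\mu$ of $T$ satisfies $\mu(\pi,\hat{\mathbf{1}}_n)=H(\operatorname{sh}(\pi))$ for all $\pi\in T$, for some function $H:S\to\mathbb{R}$ which satisfies the recursive relations $$H((n))=1,\qquad H(\alpha)=-\sum_{\substack{\alpha\prec\beta\preceq(n)\\ \beta\in S}}H(\beta)\,m(\alpha,\beta)\quad\text{for }\alpha\in S\setminus\{(n)\}.$$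
   Context: $\Pi_n$ denotes the set of all partitions of $\{1,\dots,n\}$ into nonempty disjoint blocks, ordered by refinement: $\pi\le\sigma$ iff every block of $\pi$ is contained in a block of $\sigma$ ($\sigma$ is then a coarsening of $\pi$). $\hat{\mathbf{0}}_n$ is the partition into singletons and $\hat{\mathbf{1}}_n$ the one-block partition. In a finite poset $\mathcal{X}$ with minimum $\hat{\mathbf 0}$ and maximum $\hat{\mathbf 1}$, a subset $S$ is called a lower set if it contains $\hat{\mathbf 0}$ and $\hat{\mathbf 1}$ and, for every $w\in S\setminus\{\hat{\mathbf 1}\}$ and $z\in\mathcal{X}$ with $z\le w$, one has $z\in S$. A lower set $T\subseteq\Pi_n$ carries the induced order, and its M\''obius function is $\mu(x,x)=1$, $\mu(x,y)=-\sum_{z\in T,\,x\le z<y}\mu(x,z)$ for $x<y$ in $T$, and $\mu(x,y)=0$ otherwise. $\operatorname{Par}(n)$ is the set of integer partitions of $n$, i.e. tuples $\alpha=(\alpha_1\ge\dots\ge\alpha_\ell\ge1)$ of positive integers with $\sum_i\alpha_i=n$; $\ell(\alpha)=\ell$ is the number of parts. It is ordered by: $\alpha\preceq\beta$ iff the indices of the parts of $\alpha$ can be partitioned into blocks $(G_1,\dots,G_{\ell(\beta)})$ with $\sum_{j\in G_i}\alpha_j=\beta_i$ for all $i$. Its maximum is $(n)$ and its minimum is $(1,\dots,1)$. For $\pi\in\Pi_n$, the shape $\operatorname{sh}(\pi)\in\operatorname{Par}(n)$ is the list of block sizes of $\pi$ in decreasing order. For $\alpha\preceq\beta$, $m(\alpha,\beta)$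 is the number of coarsenings in $\Pi_n$ of shape $\beta$ of a fixed partition of shape $\alpha$ (this number does not depend on the chosen partition); $m(\alpha,\beta)=0$ otherwise. *)

(* Defs.v *)
From HB Require Import structures.
From mathcomp Require Import all_boot all_order all_fingroup all_algebra.
From mathcomp Require Import reals.

Set Implicit Arguments.
Unset Strict Implicit.
Unset Printing Implicit Defensive.

Import Order.TTheory GRing.Theory Num.Theory.

(* Partitions of ['I_n] = {0, ..., n - 1}, standing for {1, ..., n}. *)
Record set_partition (n : nat) : Type := SetPartition {
  blocks :> {set {set 'I_n}};
  _ : partition blocks [set: 'I_n] }.

HB.instance Definition _ n := [isSub for @blocks n].
HB.instance Definition _ n := [Finite of set_partition n by <:].

Section SetPartitionOrder.
Variable n : nat.
Implicit Types p q r : set_partition n.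

Lemma set_partitionP p : partition p [set: 'I_n].
Proof. by case: p. Qed.

Definition refines p q : bool :=
  [forall B in blocks p, exists C in blocks q, B \subset C].

Lemma refinesP p q :
  reflect (forall B, B \in blocks p -> exists2 C, C \in blocks q & B \subset C)
          (refines p q).
Proof. exact: 'forall_in_exists_inP. Qed.

Lemma refines_refl : reflexive refines.
Proof. by move=> p; apply/refinesP => B Bp; exists B. Qed.

Lemma refines_trans : transitive refines.
Proof.
move=> q p r /refinesP pq /refinesP qr; apply/refinesP => B /pq[C /qr[D Dr CD] BC].
by exists D => //; apply: subset_trans CD.
Qed.

Lemma refines_sub p q : refines p q -> refines q p -> blocks p \subset blocks q.
Proof.
move=> /refinesP pq /refinesP qp; apply/subsetP => B Bp.
have [C Cq BC] := pq _ Bp; have [D Dp CD] := qp _ Cq.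
suff BD : B = D.
  suff -> : B = C by [].
  by apply/eqP; rewrite eqEsubset BC /= BD CD.
have /and3P[_ /trivIsetP tI n0] := set_partitionP p.
apply/eqP/negPn/negP => /(tI _ _ Bp Dp) /disjoint_setI0.
rewrite (setIidPl (subset_trans BC CD)) => B0.
by move: n0; rewrite -B0 Bp.
Qed.

Lemma refines_anti : antisymmetric refines.
Proof.
move=> p q /andP[pq qp]; apply: val_inj; apply/eqP.
by rewrite eqEsubset !refines_sub.
Qed.

(* The removal of [set0] only matters for [n = 0], where the empty family is
   the unique partition. *)
Fact one_block_subproof : partition ([set [set: 'I_n]] :\ set0) [set: 'I_n].
Proof.
apply/and3P; split; last by rewrite !inE eqxx.
- rewrite eqEsubset subsetT; apply/subsetP => x _; apply/bigcupP.
  exists [set: 'I_n]; rewrite ?inE // eqxx andbT.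
  by apply/set0Pn; exists x.
- by apply/trivIsetP => A B; rewrite !inE => /andP[_ /eqP->] /andP[_ /eqP->] /eqP.
Qed.
Definition one_block := SetPartition one_block_subproof.

Fact singletons_subproof : partition [set [set i] | i : 'I_n] [set: 'I_n].
Proof.
apply/and3P; split.
- rewrite eqEsubset subsetT; apply/subsetP => x _; apply/bigcupP.
  by exists [set x]; rewrite ?set11 ?imset_f.
- apply/trivIsetP => _ _ /imsetP[i _ ->] /imsetP[j _ ->] ij.
  by rewrite disjoints1 inE; apply: contraNN ij => /eqP->.
- by apply/imsetP => -[i _ /setP/(_ i)]; rewrite !inE eqxx.
Qed.
Definition singletons := SetPartition singletons_subproof.

Lemma refines_one_block p : refines p one_block.
Proof.
apply/refinesP => B Bp; exists [set: 'I_n]; last exact: subsetT.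
rewrite !inE eqxx andbT; apply: contraTneq Bp => T0.
have -> : B = set0 by apply/eqP; rewrite -subset0 -T0 subsetT.
by case/and3P: (set_partitionP p).
Qed.

Lemma singletons_refines p : refines singletons p.
Proof.
apply/refinesP => _ /imsetP[i _ ->].
have /and3P[/eqP cov _ _] := set_partitionP p.
have : i \in cover p by rewrite cov inE.
by case/bigcupP=> C Cp iC; exists C; rewrite ?sub1set.
Qed.

End SetPartitionOrder.

Fact set_partition_display : Order.disp_t. Proof. exact: Order.Disp tt tt. Qed.

HB.instance Definition _ n :=
  Order.Le_isPOrder.Build set_partition_display (set_partition n)
    (@refines_refl n) (@refines_anti n) (@refines_trans n).
HB.instance Definition _ n :=
  Order.hasBottom.Build set_partition_display (set_partition n)
    (@singletons_refines n).
HB.instance Definition _ n :=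
  Order.hasTop.Build set_partition_display (set_partition n)
    (@refines_one_block n).

Fact act_set_partition_subproof n (s : {perm 'I_n}) (p : set_partition n) :
  partition [set s @: B | B : {set 'I_n} in blocks p] [set: 'I_n].
Proof.
have := set_partitionP p; rewrite -(imset_partition _ _ (@perm_inj _ s)).
suff -> : [set s x | x in [set: 'I_n]] = [set: 'I_n] by [].
by apply/setP => x; rewrite inE; apply/imsetP; exists (s^-1%g x); rewrite ?permKV.
Qed.
Definition act_set_partition n (s : {perm 'I_n}) (p : set_partition n) :=
  SetPartition (act_set_partition_subproof s p).

Definition sym_invariant n (T : {set set_partition n}) : Prop :=
  forall (s : {perm 'I_n}) (p : set_partition n),
    p \in T -> act_set_partition s p \in T.

Definition is_int_partition (n : nat) (a : seq nat) : bool :=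
  [&& sorted geq a, all (leq 1) a & sumn a == n].

Record int_partition (n : nat) : Type := IntPartition {
  parts :> seq nat;
  _ : is_int_partition n parts }.

HB.instance Definition _ n := [isSub for @parts n].
HB.instance Definition _ n := [Countable of int_partition n by <:].

Section IntPartitionOrder.
Variable n : nat.
Implicit Types a b : int_partition n.

Lemma int_partitionP a : is_int_partition n a.
Proof. by case: a. Qed.

Lemma int_partition_sorted a : sorted geq a.
Proof. by case/and3P: (int_partitionP a). Qed.

Lemma int_partition_gt0 a : all (leq 1) a.
Proof. by case/and3P: (int_partitionP a). Qed.

Lemma int_partition_sumn a : sumn a = n.
Proof. by case/and3P: (int_partitionP a) => _ _ /eqP. Qed.

Lemma int_partition_nth_gt0 a i : i < size a -> 0 < nth 0 a i.
Proof. by move=> ia; apply: (allP (int_partition_gt0 a)); apply: mem_nth. Qed.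

Lemma size_le_sumn (s : seq nat) : all (leq 1) s -> size s <= sumn s.
Proof.
by elim: s => //= x s IH /andP[x0 /IH]; rewrite -add1n => /(leq_add x0).
Qed.

Lemma mem_le_sumn (s : seq nat) x : x \in s -> x <= sumn s.
Proof.
elim: s => //= y s IH; rewrite inE => /orP[/eqP->|/IH xs]; first exact: leq_addr.
exact: leq_trans xs (leq_addl _ _).
Qed.

Fact int_partition_size a : size (map (@inord n) a) <= n.
Proof.
by rewrite size_map -{2}(int_partition_sumn a) size_le_sumn ?int_partition_gt0.
Qed.

Definition int_partition_bseq a : n.-bseq 'I_n.+1 := Bseq (int_partition_size a).

Lemma int_partition_bseqK :
  pcancel int_partition_bseq
    (fun s => insub (map (@nat_of_ord n.+1) s) : option (int_partition n)).
Proof.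
move=> a; suff -> : map (@nat_of_ord _) (int_partition_bseq a) = a by apply: valK.
rewrite /= -map_comp -[RHS]map_id; apply/eq_in_map => x xa /=.
by rewrite inordK // ltnS -(int_partition_sumn a) mem_le_sumn.
Qed.

End IntPartitionOrder.

HB.instance Definition _ n :=
  isFinite.Build (int_partition n) (pcan_enumP (@int_partition_bseqK n)).

(* [merges s t]: the indices of [s] can be split into blocks, indexed by the
   entries of [t], with prescribed block sums. The [i]-th block is the fibre of
   [f] over [i]; it is nonempty as soon as the entries of [t] are positive. *)
Definition merges (s t : seq nat) : bool :=
  [exists f : {ffun 'I_(size s) -> 'I_(size t)},
    [forall i : 'I_(size t),
      \sum_(j < size s | f j == i) nth 0 s j == nth 0 t i]].

Lemma mergesP (s t : seq nat) :
  reflect (exists f : 'I_(size s) -> 'I_(size t),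
             forall i, \sum_(j < size s | f j == i) nth 0 s j = nth 0 t i)
          (merges s t).
Proof.
apply: (iffP existsP) => [[f /forallP fP]|[f fP]].
  by exists f => i; apply/eqP.
exists (finfun f); apply/forallP => i; rewrite -fP.
by apply/eqP/eq_bigl => j; rewrite ffunE.
Qed.

Lemma merges_refl : reflexive merges.
Proof.
by move=> s; apply/mergesP; exists id => i; rewrite big_pred1_eq.
Qed.

Lemma merges_trans : transitive merges.
Proof.
move=> t s u /mergesP[f fP] /mergesP[g gP]; apply/mergesP.
exists (g \o f) => i; rewrite -gP (partition_big f (fun j => g j == i)) //=.
apply: eq_bigr => j /eqP gj; rewrite -fP; apply: eq_bigl => k.
by case: (f k =P j) => [->|]; rewrite ?andbF // gj eqxx.
Qed.

Lemma merges_surj (s t : seq nat) (f : 'I_(size s) -> 'I_(size t)) :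
    all (leq 1) t ->
    (forall i, \sum_(j < size s | f j == i) nth 0 s j = nth 0 t i) ->
  forall i, i \in codom f.
Proof.
move=> t0 fP i; apply: contraTT (allP t0 (nth 0 t i) (mem_nth _ (ltn_ord i))).
move=> iNf; rewrite -fP big_pred0 // => j; apply: contraNF iNf => /eqP<-.
exact: codom_f.
Qed.

Lemma merges_size (s t : seq nat) :
  all (leq 1) t -> merges s t -> size t <= size s.
Proof.
move=> t0 /mergesP[f /(merges_surj t0) fS].
have: #|'I_(size t)| <= #|codom f| by apply: subset_leq_card; apply/subsetP => i _.
move/leq_trans/(_ (leq_image_card _ _)).
by rewrite !card_ord.
Qed.

Lemma merges_perm (s t : seq nat) :
  all (leq 1) t -> size s = size t -> merges s t -> perm_eq s t.
Proof.
move=> t0 st /mergesP[f fP]; have fS := merges_surj t0 fP.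
have fI : injective f.
  apply/injectiveP/card_uniqP; rewrite size_map -cardE card_ord.
  by rewrite (eq_card (B := 'I_(size t))) ?card_ord // => i; rewrite fS inE.
have E j : nth 0 t (f j) = nth 0 s j.
  by rewrite -fP (big_pred1 j) // => k; apply: inj_eq.
have Et : t = [seq nth 0 t (i : nat) | i : 'I_(size t) <- enum 'I_(size t)].
  by rewrite (map_comp (nth 0 t)) val_enum_ord -/(mkseq _ _) mkseq_nth.
have Es : s = [seq nth 0 t (i : nat) | i : 'I_(size t) <- map f (enum 'I_(size s))].
  rewrite -map_comp (eq_map (g := (nth 0 s) \o val)); last by move=> j /=.
  by rewrite map_comp val_enum_ord -/(mkseq _ _) mkseq_nth.
apply: (perm_trans (y := [seq nth 0 t (i : nat) | i : 'I_(size t) <- enum 'I_(size t)]));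
  last by rewrite -Et.
apply: (eq_ind_r (fun u => perm_eq u _) _ Es).
apply: perm_map; apply: uniq_perm.
- by rewrite map_inj_uniq ?enum_uniq.
- exact: enum_uniq.
- by move=> i; rewrite mem_enum; apply: fS.
Qed.

Lemma merges_ones (t : seq nat) : merges (nseq (sumn t) 1) t.
Proof.
have Et : sumn t = \sum_(i < size t) nth 0 t i.
  by rewrite sumnE (big_nth 0) big_mkord.
have szE : size (nseq (sumn t) 1) = \sum_(i < size t) nth 0 t i.
  by rewrite size_nseq.
apply/mergesP; exists (fun j => tagnat.sig1 (cast_ord szE j)) => i.
have one (j : 'I_(size (nseq (sumn t) 1))) : nth 0 (nseq (sumn t) 1) j = 1.
  have jt : j < sumn t by have := ltn_ord j; rewrite {2}size_nseq.
  by rewrite nth_nseq jt.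
under eq_bigr => j _ do rewrite one.
rewrite (reindex (cast_ord (esym szE))) /=; last first.
  by exists (cast_ord szE) => j _; rewrite ?cast_ordK ?cast_ordKV.
under eq_bigl => j do rewrite cast_ordKV.
rewrite (reindex _ (onW_bij _ (tagnat.rank_bij (p_ := fun i => nth 0 t i)))) /=.
under eq_bigl => p do rewrite /tagnat.sig1 tagnat.rankK.
have := sig_big_dep (op := addn) (idx := 0) (I := 'I_(size t)) (J := fun i => 'I_(nth 0 t i))
  (fun j => j == i) (fun _ _ => true) (fun _ _ => 1).
rewrite /= big_pred1_eq sum1_card card_ord => ->.
by apply: eq_bigl => p; rewrite andbT.
Qed.

Section IntPartitionOrder.
Variable n : nat.
Implicit Types a b : int_partition n.

Lemma merges_anti : antisymmetric (fun a b => merges a b).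
Proof.
move=> a b /andP[ab ba]; apply: val_inj => /=.
have [a0 b0] := (int_partition_gt0 a, int_partition_gt0 b).
have szE : size a = size b.
  by apply/eqP; rewrite eqn_leq (merges_size a0 ba) (merges_size b0 ab).
apply: (sorted_eq (leT := geq)).
- by move=> y x z /= yx zy; apply: leq_trans zy yx.
- by move=> x y /andP[? ?]; apply/eqP; rewrite eqn_leq; apply/andP.
- exact: int_partition_sorted.
- exact: int_partition_sorted.
- exact: merges_perm.
Qed.

Fact all_ones_subproof : is_int_partition n (nseq n 1).
Proof.
apply/and3P; split; last by rewrite sumn_nseq mul1n.
- by case: n => // m /=; elim: m => //= m ->.
- by apply/allP => x /nseqP[->].
Qed.
Definition all_ones := IntPartition all_ones_subproof.

(* The partition [(n)]; for [n = 0] it is the empty sequence, which is then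
   the unique partition. *)
Fact one_part_subproof : is_int_partition n (nseq (0 < n) n).
Proof. by case: n => // m; rewrite /is_int_partition /= addn0 eqxx. Qed.
Definition one_part := IntPartition one_part_subproof.

Lemma all_ones_merges a : merges all_ones a.
Proof. by have := merges_ones a; rewrite int_partition_sumn. Qed.

Lemma merges_one_part a : merges a one_part.
Proof.
have an := int_partition_sumn a; apply/mergesP => /=.
case: (posnP n) an => [n0|n_gt0] an.
  have /size0nil -> : size a = 0.
    apply/eqP; rewrite -leqn0 -n0 -{2}an.
    by rewrite size_le_sumn ?int_partition_gt0.
  by exists (cast_ord (esym (size_nseq 0 n))) => -[i iP]; exfalso; move: iP.
exists (fun=> @Ordinal (size (nseq 1 n)) 0 isT) => -[[|//] i0] /=.
by rewrite -[RHS]an sumnE (big_nth 0) big_mkord; apply: eq_bigl.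
Qed.

End IntPartitionOrder.

Fact int_partition_display : Order.disp_t. Proof. exact: Order.Disp tt tt. Qed.

HB.instance Definition _ n :=
  Order.Le_isPOrder.Build int_partition_display (int_partition n)
    (fun a => merges_refl a) (@merges_anti n)
    (fun b a c => @merges_trans b a c).
HB.instance Definition _ n :=
  Order.hasBottom.Build int_partition_display (int_partition n)
    (@all_ones_merges n).
HB.instance Definition _ n :=
  Order.hasTop.Build int_partition_display (int_partition n)
    (@merges_one_part n).

Fact shape_subproof n (p : set_partition n) :
  is_int_partition n (sort geq [seq #|B| | B : {set 'I_n} <- enum (blocks p)]).
Proof.
have pP := set_partitionP p; apply/and3P; split.
- by apply: sort_sorted => x y; apply: leq_total.
- rewrite all_sort; apply/allP => _ /mapP[B + ->]; rewrite mem_enum => Bp.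
  rewrite card_gt0; apply: contraTneq Bp => ->.
  by case/and3P: pP.
- rewrite (perm_sumn (s2 := [seq #|B| | B : {set 'I_n} <- enum (blocks p)])).
    by rewrite sumnE big_map big_enum -(card_partition pP) cardsT card_ord.
  exact/permPl/perm_sort.
Qed.
Definition partition_shape n (p : set_partition n) : int_partition n :=
  IntPartition (shape_subproof p).

(* The partition of shape [a] whose coarsenings are counted is an arbitrary one;
   the count does not depend on it. *)
Definition coarsenings_of_shape n (a b : int_partition n) : nat :=
  if (a <= b)%O then
    if [pick p : set_partition n | partition_shape p == a] is Some p
    then #|[set q : set_partition n | (p <= q)%O && (partition_shape q == b)]|
    else 0
  else 0.

Definition lower_set d (X : finTBPOrderType d) (S : {set X}) : Prop :=
  [/\ (\bot)%O \in S, (\top)%O \in S &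
      forall w z : X, w \in S -> w != (\top)%O -> (z <= w)%O -> z \in S].

Section Mobius.
Local Open Scope ring_scope.
Variables (d : Order.disp_t) (X : finPOrderType d) (T : {set X}).

Fixpoint mobius_rec (k : nat) (x y : X) : int :=
  if x == y then 1 else
  if (x < y)%O then
    if k is k'.+1 then - \sum_(z in T | (x <= z < y)%O) mobius_rec k' x z else 0
  else 0.

(* The Möbius function of [T] with the induced order; only its values at
   [x, y \in T] are meaningful. The number [#|X|] is enough fuel for the
   recursion to be exact: see [mobius_lt]. *)
Definition mobius (x y : X) : int := mobius_rec #|X| x y.

Lemma mobius_rec_stable k k' x y :
  (#|[set z | (z < y)%O]| <= k)%N -> (#|[set z | (z < y)%O]| <= k')%N ->
  mobius_rec k x y = mobius_rec k' x y.
Proof.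
elim: k k' y => [|k IH] [|k'] y //=; case: ifP => // _; case: ifP => // xy.
- by rewrite leqn0 cards_eq0 => /eqP/setP/(_ x); rewrite !inE xy.
- by move=> _; rewrite leqn0 cards_eq0 => /eqP/setP/(_ x); rewrite !inE xy.
move=> yk yk'; congr (- _); apply: eq_bigr => z /and3P[_ _ zy].
have sub : (#|[set u | (u < z)%O]| < #|[set u | (u < y)%O]|)%N.
  apply: proper_card; apply/properP; split.
    by apply/subsetP => u; rewrite !inE => uz; apply: lt_trans zy.
  by exists z; rewrite inE ?ltxx ?zy.
by apply: IH; rewrite -ltnS; apply: leq_trans sub _.
Qed.

Lemma mobiusxx x : mobius x x = 1.
Proof. by rewrite /mobius; case: #|X| => [|k] /=; rewrite eqxx. Qed.

Lemma mobius_lt x y : (x < y)%O ->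
  mobius x y = - \sum_(z in T | (x <= z < y)%O) mobius x z.
Proof.
move=> xy.
have -> : mobius x y = mobius_rec #|X|.+1 x y.
  apply: mobius_rec_stable; first exact: max_card.
  exact: leq_trans (max_card _) (leqnSn _).
by rewrite /= xy (lt_eqF xy).
Qed.

Lemma mobius_nle x y : ~~ (x <= y)%O -> mobius x y = 0.
Proof.
rewrite /mobius; case: #|X| => [|k] /=; rewrite le_eqVlt negb_or.
all: by case/andP=> /negPf-> /negPf->.
Qed.

End Mobius.

(* Main.v *)
Require Import Defs.
From mathcomp Require Import all_boot all_order all_fingroup all_algebra.
From mathcomp Require Import reals.

Set Implicit Arguments.
Unset Strict Implicit.
Unset Printing Implicit Defensive.

Import Order.TTheory GRing.Theory Num.Theory.

(** The theorem rests on one picture of the shape map.  A set partition of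
    shape [a] is the family of fibres of a labelling [f : 'I_n -> 'I_(size a)]
    whose [i]-th fibre has [a_i] elements.  Refinement says that one labelling
    factors through another, permutations of ['I_n] act by precomposition, and a
    merging of the parts of [a] into the parts of [b] is a map [h] such that
    [h \o f] is a labelling for [b].  Two labellings with the same fibre sizes
    differ by a permutation of ['I_n] ([perm_of_labels]).  Four facts follow:

    - the orbits of the symmetric group on set partitions are the shape classes
      ([shape_act], [act_of_shape]);
    - the shape is strictly increasing ([le_shape], [lt_shape]);
    - every integer partition below the shape of [q] is the shape of some
      refinement of [q] ([exists_refinement_of_shape]);
    - the number of coarsenings of [p] of shape [b] depends only on the shape of
      [p] ([coarsenings_of_shapeE]).

    Invariant sets of set partitions are therefore the preimages of sets of
    shapes; since refinements have smaller shapes and every smaller shape comes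
    from a refinement, lower sets correspond to lower sets.  The permutations
    are automorphisms of the poset [T] fixing its maximum, so [mobius T p \top]
    is a function [H] of the shape of [p].  The Möbius function is defined by a
    recursion on the upper end of an interval; like any left inverse of the
    zeta function it is also a right inverse, which gives a recursion on the
    lower end ([mobius_lt_dual]).  Grouping the terms of the latter by shape
    turns it into the recursion for [H]. *)

(** * Set partitions as fibres of labellings *)

Definition fibre_partition (n : nat) (I : finType) (f : 'I_n -> I) :
    set_partition n :=
  SetPartition (preim_partitionP f [set: 'I_n]).

Lemma le_fibre_partition n (I J : finType) (f : 'I_n -> I) (g : 'I_n -> J) :
  reflect (forall x y, f x = f y -> g x = g y)
          (fibre_partition f <= fibre_partition g)%O.
Proof.
apply: (iffP (refinesP _ _)) => [fg x y fxy | fg B /imsetP[x _ ->]].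
  have /fg[C /imsetP[z _ ->] /subsetP sub] :
      [set t in [set: 'I_n] | f x == f t] \in fibre_partition f.
    by apply/imsetP; exists x.
  have := sub x; have := sub y.
  by rewrite !inE fxy eqxx => /(_ isT)/eqP <- /(_ isT)/eqP <-.
exists [set t in [set: 'I_n] | g x == g t]; first by apply/imsetP; exists x.
by apply/subsetP => y; rewrite !inE => /eqP/fg/eqP.
Qed.

Lemma act_fibre_partition n (I : finType) (f : 'I_n -> I) (s : {perm 'I_n}) :
  act_set_partition s (fibre_partition f) = fibre_partition (f \o (s^-1)%g).
Proof.
have img x : s @: [set y in [set: 'I_n] | f x == f y] =
    [set y in [set: 'I_n] | (f \o (s^-1)%g) (s x) == (f \o (s^-1)%g) y].
  apply/setP => y; rewrite -{1}[y](permKV s) (mem_imset _ _ (@perm_inj _ s)).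
  by rewrite !inE /= permK.
apply: val_inj; apply/setP => B; apply/imsetP/imsetP => -[].
  by move=> _ /imsetP[x _ ->] ->; exists (s x); rewrite ?inE ?img.
move=> x _ ->; exists [set y in [set: 'I_n] | f ((s^-1)%g x) == f y].
  by apply/imsetP; exists ((s^-1)%g x).
by rewrite img permKV.
Qed.

(** The labels are the indices of the parts of [a], so that the maps [h] in the
    definition of [merges] can be composed with labellings. *)
Definition labels (n : nat) (a : int_partition n) (f : 'I_n -> 'I_(size a)) :=
  forall i, #|[set x | f x == i]| = nth 0 a i.

Lemma labels_onto n (a : int_partition n) (f : 'I_n -> 'I_(size a)) i :
  labels f -> {x | f x = i}.
Proof.
move=> fP; suff: [exists x, f x == i].
  move=> H; have {}H : exists x, f x == i by apply/existsP.
  by exists (xchoose H); apply/eqP/(xchooseP H).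
have := int_partition_nth_gt0 (ltn_ord i).
by rewrite -fP => /card_gt0P[x]; rewrite inE => ?; apply/existsP; exists x.
Qed.

(** The fibre of [h \o f] over [i] is the union of the fibres of [f] over the
    preimages of [i]: merging parts is composing labellings. *)
Lemma labels_comp n (a b : int_partition n) (f : 'I_n -> 'I_(size a))
    (h : 'I_(size a) -> 'I_(size b)) :
    labels f ->
    (forall i, \sum_(j < size a | h j == i) nth 0 a j = nth 0 b i) <->
  labels (h \o f).
Proof.
move=> fP; have E i : #|[set x | h (f x) == i]| =
    \sum_(j < size a | h j == i) nth 0 a j.
  rewrite -sum1_card (partition_big f (fun j => h j == i)) /=; last first.
    by move=> x; rewrite inE.
  apply: eq_bigr => j /eqP hj; rewrite -fP -sum1_card; apply: eq_bigl => x.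
  by rewrite !inE; case: (f x =P j) => [->|_]; rewrite ?andbF ?hj ?eqxx.
by split=> H i; [rewrite -H -E | rewrite -E -H]; apply: eq_card => x;
  rewrite !inE.
Qed.

(** When the fibres of [f] refine those of [g], the labelling [g] factors as
    [h \o f], and this [h] merges the parts of [a] into those of [b]. *)
Lemma labels_le n (a b : int_partition n)
    (f : 'I_n -> 'I_(size a)) (g : 'I_n -> 'I_(size b)) :
    labels f -> labels g -> (fibre_partition f <= fibre_partition g)%O ->
  (a <= b)%O.
Proof.
move=> fP gP /le_fibre_partition fg; apply/mergesP.
pose h i := g (sval (labels_onto i fP)).
have hf x : h (f x) = g x by apply: fg; case: labels_onto.
exists h; apply: (labels_comp h fP).2 => i.
by rewrite -gP; apply: eq_card => x; rewrite !inE /= hf.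
Qed.

(** Listing the blocks by decreasing size, a point is labelled by the position
    of its block in the list. *)
Lemma exists_labels_shape n (p : set_partition n) :
  exists2 f : 'I_n -> 'I_(size (partition_shape p)),
    labels f & fibre_partition f = p.
Proof.
have /and3P[/eqP cov tI n0] := set_partitionP p.
have pb x : pblock p x \in blocks p by rewrite pblock_mem // cov inE.
pose bs := sort (relpre (fun B : {set 'I_n} => #|B|) geq) (enum (blocks p)).
have shE : partition_shape p = [seq #|B| | B : {set 'I_n} <- bs] :> seq nat.
  by rewrite /= sort_map.
have mem_bs B : (B \in bs) = (B \in blocks p) by rewrite mem_sort mem_enum.
have nth_shape k : k < size bs ->
    nth 0 (partition_shape p) k = #|nth set0 bs k|.
  by move=> kb; rewrite shE (nth_map set0).
have ltb x : index (pblock p x) bs < size (partition_shape p).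
  by rewrite shE size_map index_mem mem_bs.
have fE x y : (Ordinal (ltb x) == Ordinal (ltb y)) = (pblock p x == pblock p y).
  rewrite -val_eqE /=; apply/eqP/eqP => [|->//].
  by move/(congr1 (nth set0 bs)); rewrite !nth_index ?mem_bs.
exists (fun x => Ordinal (ltb x)) => [i|].
  have ib : i < size bs by have := ltn_ord i; rewrite {2}shE size_map.
  rewrite nth_shape //.
  apply: eq_card => x.
  have ip : nth set0 bs i \in blocks p by rewrite -mem_bs mem_nth.
  rewrite inE -val_eqE /=; apply/eqP/idP => [<-|xi].
    by rewrite nth_index ?mem_bs // mem_pblock cov inE.
  by rewrite (def_pblock tI ip xi) index_uniq // sort_uniq enum_uniq.
apply: val_inj => /=; rewrite -[RHS](preim_partition_pblock (set_partitionP p)).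
apply: eq_imset => x; apply/setP => y.
by rewrite !inE fE.
Qed.

(** The values of [f] and of [g], listed along ['I_n], contain each label the
    same number of times, so one list is a rearrangement of the other. *)
Lemma perm_of_labels n (a : int_partition n) (f g : 'I_n -> 'I_(size a)) :
  labels f -> labels g -> exists s : {perm 'I_n}, f =1 g \o s.
Proof.
move=> fP gP.
have : perm_eq [tuple f i | i < n] [tuple g i | i < n].
  have cnt (h : 'I_n -> 'I_(size a)) : labels h ->
      forall i, count_mem i [tuple h x | x < n] = nth 0 a i.
    move=> hP i; rewrite count_map -hP -sum1_count -sum1_card big_enum_cond /=.
    by apply: eq_bigl => x; rewrite inE.
  by apply/allP => i _; rewrite /= !cnt.
case/tuple_permP => s E; exists s => x.
have := congr1 (fun t => nth (f x) t x) E.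
by rewrite -!tnth_nth !tnth_mktuple.
Qed.

Lemma labels_perm n (a : int_partition n) (f : 'I_n -> 'I_(size a))
  (s : {perm 'I_n}) : labels f -> labels (f \o s).
Proof.
move=> fP i; rewrite -fP -[RHS](card_preimset _ (@perm_inj _ s)).
by apply: eq_card => x; rewrite !inE.
Qed.

(** The shape of the fibre partition comes with a labelling having the same
    fibres as [f]; comparing the two labellings both ways, the shape equals [a]
    by antisymmetry, with no computation on sorted lists. *)
Lemma shape_fibre_partition n (a : int_partition n) (f : 'I_n -> 'I_(size a)) :
  labels f -> partition_shape (fibre_partition f) = a.
Proof.
move=> fP; have [g gP gf] := exists_labels_shape (fibre_partition f).
by apply: le_anti; rewrite (labels_le fP gP) ?(labels_le gP fP) ?gf.
Qed.

(** A merging of [n] parts equal to 1 into the parts of [a] is already a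
    labelling of ['I_n] by the parts of [a]. *)
Lemma exists_labels n (a : int_partition n) :
  exists f : 'I_n -> 'I_(size a), labels f.
Proof.
have /mergesP[h hP] := all_ones_merges a.
have E : n = size (all_ones n) by rewrite size_nseq.
exists (h \o cast_ord E); apply: (labels_comp (a := all_ones n) h _).1 hP => i.
have in_n : i < n by rewrite [ltnRHS]E.
rewrite nth_nseq in_n (eq_card1 (x := cast_ord (esym E) i)) // => x.
by rewrite !inE -[in RHS](cast_ordK E x) (inj_eq (@cast_ord_inj _ _ _)).
Qed.

(** * Shapes, refinement and the symmetric group *)

Lemma shape_act n (s : {perm 'I_n}) (p : set_partition n) :
  partition_shape (act_set_partition s p) = partition_shape p.
Proof.
have [f fP fp] := exists_labels_shape p.
rewrite -{1}fp act_fibre_partition shape_fibre_partition //.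
exact: labels_perm.
Qed.

Lemma act_of_shape n (p q : set_partition n) :
  partition_shape p = partition_shape q ->
  exists s : {perm 'I_n}, act_set_partition s p = q.
Proof.
have [f fP <-] := exists_labels_shape p.
have [g gP <-] := exists_labels_shape q.
rewrite !shape_fibre_partition // => E; move: f g fP gP; rewrite E => f g fP gP.
have [s fg] := perm_of_labels gP fP.
exists (s^-1)%g; rewrite act_fibre_partition invgK.
apply: le_anti; apply/andP; split; apply/le_fibre_partition => x y;
  by rewrite !fg.
Qed.

Lemma act_set_partition_homo n (s : {perm 'I_n}) :
  {homo act_set_partition s : p q / (p <= q)%O}.
Proof.
move=> p q; have [f _ <-] := exists_labels_shape p.
have [g _ <-] := exists_labels_shape q; rewrite !act_fibre_partition.
by move=> /le_fibre_partition fg; apply/le_fibre_partition => x y /fg.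
Qed.

Lemma act_set_partitionK n (s : {perm 'I_n}) :
  cancel (act_set_partition s) (act_set_partition (s^-1)%g).
Proof.
move=> p; have [f _ <-] := exists_labels_shape p; rewrite !act_fibre_partition.
by apply: le_anti; apply/andP; split; apply/le_fibre_partition => x y;
   rewrite /= invgK !permK.
Qed.

Lemma act_set_partition_le_mono n (s : {perm 'I_n}) :
  {mono act_set_partition s : p q / (p <= q)%O}.
Proof.
move=> p q; apply/idP/idP; last exact: act_set_partition_homo.
move=> /(act_set_partition_homo (s^-1)%g).
by rewrite !act_set_partitionK.
Qed.

Lemma le_shape n (p q : set_partition n) :
  (p <= q)%O -> (partition_shape p <= partition_shape q)%O.
Proof.
have [f fP fp] := exists_labels_shape p.
have [g gP gq] := exists_labels_shape q.
by rewrite -{1}fp -{1}gq => /(labels_le fP gP).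
Qed.

(** Write [q = s p] for a permutation [s].  From [p <= s p] and monotonicity,
    the iterates of [s] ascend from [p]; as [s] has finite order they return to
    [p], so [s p <= p]. *)
Lemma eq_shape_le n (p q : set_partition n) :
  (p <= q)%O -> partition_shape p = partition_shape q -> p = q.
Proof.
move=> pq /act_of_shape[s sp]; apply: le_anti; rewrite pq /=.
have {}pq : (p <= act_set_partition s p)%O by rewrite sp.
have up k : (act_set_partition s p <= iter k.+1 (act_set_partition s) p)%O.
  by elim: k => //= k /(le_trans pq); apply: act_set_partition_homo.
rewrite -sp; have := up (fingraph.order (act_set_partition s) p).-1.
rewrite prednK ?order_gt0 // iter_order //.
exact: can_inj (act_set_partitionK s).
Qed.

Lemma lt_shape n (p q : set_partition n) :
  (p < q)%O -> (partition_shape p < partition_shape q)%O.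
Proof.
rewrite !lt_def => /andP[qp pq]; rewrite le_shape // andbT.
by apply: contraNneq qp => /esym/(eq_shape_le pq)->.
Qed.

(** Any labelling [f] for [a], followed by the merging [h], is a labelling for
    the shape of [q]; a permutation of the points then makes its fibres the
    blocks of [q], and the same permutation applied to [f] yields the desired
    refinement. *)
Lemma exists_refinement_of_shape n (a : int_partition n) (q : set_partition n) :
  (a <= partition_shape q)%O ->
  exists2 p : set_partition n, (p <= q)%O & partition_shape p = a.
Proof.
move=> /mergesP[h hP]; have [f fP] := exists_labels a.
have [g gP gq] := exists_labels_shape q.
have hfP : labels (h \o f) by apply/(labels_comp h fP).
have [s gs] := perm_of_labels gP hfP.
exists (fibre_partition (f \o s)).
  by rewrite -gq; apply/le_fibre_partition => x y /= fxy; rewrite !gs /= fxy.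
by apply: shape_fibre_partition; apply: labels_perm.
Qed.

(** Every integer partition is a shape, so a monotone shape map sends the
    maximum to the maximum; the same holds for the minimum below. *)
Lemma shape_top n : partition_shape (\top : set_partition n)%O = (\top)%O.
Proof.
have [f fP] := exists_labels (\top : int_partition n)%O.
apply: le_anti; rewrite lex1 /= -{1}(shape_fibre_partition fP).
by apply: le_shape; apply: lex1.
Qed.

Lemma shape_bot n : partition_shape (\bot : set_partition n)%O = (\bot)%O.
Proof.
have [f fP] := exists_labels (\bot : int_partition n)%O.
apply: le_anti; rewrite le0x andbT -(shape_fibre_partition fP).
by apply: le_shape; apply: le0x.
Qed.

(** A permutation taking one partition of shape [a] to another maps the
    coarsenings of the first bijectively to those of the second and preserves
    their shapes; hence any [p] can stand for the representative chosen in the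
    definition. *)
Lemma coarsenings_of_shapeE n (p : set_partition n) (b : int_partition n) :
  coarsenings_of_shape (partition_shape p) b =
  #|[set q : set_partition n | (p <= q)%O && (partition_shape q == b)]|.
Proof.
rewrite /coarsenings_of_shape; case: ifPn => [_|ab]; last first.
  rewrite eq_card0 // => q; rewrite !inE; apply: contraNF ab.
  by case/andP=> /le_shape + /eqP<-.
case: pickP => [p' /eqP/act_of_shape[s <-]|/(_ p)]; last by rewrite eqxx.
rewrite -[RHS](card_preimset _ (can_inj (act_set_partitionK s))).
by apply: eq_card => q; rewrite !inE act_set_partition_le_mono shape_act.
Qed.

(** * Symmetry and duality of the Möbius function *)

Local Open Scope ring_scope.

Lemma mobius_automorphism d (X : finPOrderType d) (T : {set X}) (f : X -> X) :
    {mono f : x y / (x <= y)%O} -> (forall x, (f x \in T) = (x \in T)) ->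
  forall x y, mobius T (f x) (f y) = mobius T x y.
Proof.
move=> fle fT; have finj : injective f := inc_inj fle.
have flt : {mono f : x y / (x < y)%O} by apply: leW_mono.
rewrite /mobius; elim: #|X| => [|k IH] x y /=; rewrite (inj_eq finj) flt //.
case: ifP => // _; case: ifP => // _; congr (- _).
rewrite (reindex_inj finj); apply: eq_big => [z|z _]; last exact: IH.
by rewrite fT fle flt.
Qed.

(** Strong induction on [y].  Expanding [mobius T z y] for [z < y] by the
    defining recursion and exchanging the sums leaves, for each [w] in
    [[x, y)], the sum of [mobius T z w] over [z] in [[x, w]], which is
    [(x == w)] by induction; only [w = x] contributes, and it cancels
    [mobius T y y = 1]. *)
Lemma sum_mobius_lower d (X : finPOrderType d) (T : {set X}) (x y : X) :
    x \in T -> y \in T -> (x <= y)%O ->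
  \sum_(z in T | (x <= z <= y)%O) mobius T z y = (x == y)%:R.
Proof.
have [k] := ubnP #|[set u | (u < y)%O]|; elim: k y => // k IH y le_k xT yT xy.
rewrite (bigD1 y) ?yT ?xy ?lexx //= mobiusxx.
rewrite (eq_bigl (fun z => (z \in T) && (x <= z < y)%O)); last first.
  by move=> z; rewrite lt_neqAle -!andbA; do !bool_congr.
have [->|x_neq_y] := eqVneq x y.
  rewrite big_pred0 ?addr0 // => z.
  by apply/negP => /and3P[_ yz /(le_lt_trans yz)]; rewrite ltxx.
have ltxy : (x < y)%O by rewrite lt_neqAle x_neq_y.
under eq_bigr => z /and3P[_ _ zy] do rewrite mobius_lt //.
rewrite sumrN.
rewrite (exchange_big_dep (fun w => (w \in T) && (x <= w < y)%O)) /=; last first.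
  by move=> z w /and3P[zT xz zy] /and3P[-> /(le_trans xz)-> ->].
rewrite (eq_bigr (fun w => (x == w)%:R)) => [|w /and3P[wT xw wy]]; last first.
  rewrite -IH //.
    apply: eq_bigl => z; rewrite wT wy andbT -andbA /=.
    case: (boolP (z <= w)%O) => [zw|_]; last by rewrite !andbF.
    by rewrite (le_lt_trans zw wy) !andbT.
  apply: leq_trans (le_k : (_ <= k)%N); apply: proper_card.
  apply/properP; split.
    by apply/subsetP => u; rewrite !inE => /lt_trans; apply.
  by exists w; rewrite inE ?ltxx ?wy.
rewrite (bigD1 x) ?xT ?lexx ?ltxy //= eqxx big1 ?addr0 ?subrr // => w.
by case/andP=> _; rewrite eq_sym => /negPf->.
Qed.

Lemma mobius_lt_dual d (X : finPOrderType d) (T : {set X}) (x y : X) :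
    x \in T -> y \in T -> (x < y)%O ->
  mobius T x y = - \sum_(z in T | (x < z <= y)%O) mobius T z y.
Proof.
move=> xT yT xy; have := sum_mobius_lower xT yT (ltW xy).
rewrite (bigD1 x) ?xT ?lexx ?ltW //= (lt_eqF xy) => /eqP; rewrite addr_eq0.
move/eqP->; congr (- _); apply: eq_bigl => z.
by rewrite lt_neqAle eq_sym -!andbA; do !bool_congr.
Qed.

(** * Invariant lower sets and the recursion by shapes *)

Lemma mem_shape_imset n (T : {set set_partition n}) (p : set_partition n) :
  sym_invariant T ->
  (partition_shape p \in [set partition_shape q | q in T]) = (p \in T).
Proof.
move=> Tsym; apply/imsetP/idP => [[q qT /esym/act_of_shape[s <-]]|pT].
  exact: Tsym.
by exists p.
Qed.

(** Below the shape of [p], every integer partition is the shape of a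
    refinement of [p], which lies in [T] as soon as [p] does and is not the
    one-block partition. *)
Lemma lower_set_shapes n (T : {set set_partition n}) :
  lower_set T -> sym_invariant T ->
  lower_set [set partition_shape p | p in T].
Proof.
move=> [T0 T1 Tlow] Tsym; split.
- by rewrite -shape_bot mem_shape_imset.
- by rewrite -shape_top mem_shape_imset.
move=> _ a /imsetP[p pT ->] p1 /exists_refinement_of_shape[q qp <-].
rewrite mem_shape_imset //; apply: Tlow qp => //.
by apply: contraNneq p1 => ->; rewrite shape_top.
Qed.

(** The condition [w != \top] transfers because only the one-block partition
    has the maximal shape. *)
Lemma lower_set_of_shapes n (S : {set int_partition n}) :
  lower_set S -> lower_set [set p : set_partition n | partition_shape p \in S].
Proof.
move=> [S0 S1 Slow]; split; rewrite ?inE ?shape_bot ?shape_top //.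
move=> p q; rewrite !inE => pS p1 /le_shape; apply: Slow => //.
apply: contraNneq p1; rewrite -shape_top => /eq_shape_le -> //.
Qed.

Lemma sym_invariant_of_shapes n (S : {set int_partition n}) :
  sym_invariant [set p : set_partition n | partition_shape p \in S].
Proof. by move=> s p; rewrite !inE shape_act. Qed.

(** A permutation taking [p] to [q] is an automorphism of [T] fixing [\top]. *)
Lemma mobius_top_shape n (T : {set set_partition n}) (p q : set_partition n) :
  sym_invariant T -> partition_shape p = partition_shape q ->
  mobius T p (\top)%O = mobius T q (\top)%O.
Proof.
move=> Tsym /act_of_shape[s <-].
have actT r : (act_set_partition s r \in T) = (r \in T).
  by apply/idP/idP => [/(Tsym s^-1%g)|/Tsym//]; rewrite act_set_partitionK.
have fix_top : act_set_partition s (\top)%O = (\top)%O.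
  by apply/(eq_shape_le (lex1 _)); rewrite shape_act.
by rewrite -{2}fix_top mobius_automorphism //; apply: act_set_partition_le_mono.
Qed.

(** Since the shape is strictly increasing, the strict coarsenings of [p] fall
    into classes indexed by the shapes strictly above that of [p]. *)
Lemma sum_coarsenings_by_shape (V : zmodType) n (T : {set set_partition n})
    (S : {set int_partition n}) (p : set_partition n)
    (H : int_partition n -> V) :
    (forall q : set_partition n, q \in T <-> partition_shape q \in S) ->
  \sum_(q in T | (p < q)%O) H (partition_shape q) =
  \sum_(b in S | (partition_shape p < b)%O)
    H b *+ coarsenings_of_shape (partition_shape p) b.
Proof.
move=> TS; rewrite (partition_big (@partition_shape n)
    (fun b => (b \in S) && (partition_shape p < b)%O)) /=; last first.
  by move=> q /andP[/TS-> /lt_shape->].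
apply: eq_bigr => b /andP[bS pb].
rewrite coarsenings_of_shapeE -sumr_const; apply: eq_big => [q|q]; last first.
  by case/andP=> _ /eqP->.
rewrite inE; have [qb|] := eqVneq (partition_shape q) b; last by rewrite !andbF.
have -> : q \in T by apply/TS; rewrite qb.
rewrite !andbT /= lt_neqAle.
by have [pq|//] := eqVneq p q; move: pb; rewrite -qb pq ltxx.
Qed.

Theorem theorem3p9 (R : realType) (n : nat) :
  [/\ (forall T : {set set_partition n}, lower_set T -> sym_invariant T ->
         exists S : {set int_partition n},
           lower_set S /\
           (forall p : set_partition n, p \in T <-> partition_shape p \in S)),
      (forall S : {set int_partition n}, lower_set S ->
         lower_set [set p : set_partition n | partition_shape p \in S] /\
         sym_invariant [set p : set_partition n | partition_shape p \in S])
    & (forall (T : {set set_partition n}) (S : {set int_partition n}),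
         lower_set T -> sym_invariant T -> lower_set S ->
         (forall p : set_partition n, p \in T <-> partition_shape p \in S) ->
         exists H : int_partition n -> R,
           [/\ (forall p : set_partition n, p \in T ->
                  (mobius T p (\top)%O)%:~R = H (partition_shape p)),
               H (\top)%O = 1
             & (forall a : int_partition n, a \in S -> a != (\top)%O ->
                  H a = - \sum_(b in S | (a < b <= \top)%O)
                            H b * (coarsenings_of_shape a b)%:R)])].
Proof.
split=> [T Tlow Tsym | S Slow | T S [_ T1 _] Tsym _ TS].
- exists [set partition_shape p | p in T]; split; first exact: lower_set_shapes.
  by move=> p; rewrite mem_shape_imset.
- by split; [apply: lower_set_of_shapes | apply: sym_invariant_of_shapes].
(* The value at [a] is read off any set partition of shape [a]; the default
   0 is never reached because every integer partition is a shape. *)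
pose H (a : int_partition n) : R :=
  if [pick p : set_partition n | partition_shape p == a] is Some p
  then (mobius T p (\top)%O)%:~R else 0.
have HE p : H (partition_shape p) = (mobius T p (\top)%O)%:~R.
  rewrite /H; case: pickP => [q /eqP|/(_ p)]; last by rewrite eqxx.
  by move=> /(mobius_top_shape Tsym)->.
exists H; split=> [p _||a aS a1]; first by rewrite HE.
  by rewrite -shape_top HE mobiusxx.
have : (a <= partition_shape (\top : set_partition n))%O by rewrite shape_top lex1.
case/exists_refinement_of_shape=> p _ ap; rewrite -ap in aS a1 *.
have p_lt1 : (p < \top)%O.
  by rewrite lt_neqAle lex1 andbT; apply: contraNneq a1 => ->; rewrite shape_top.
rewrite HE mobius_lt_dual //; last exact/TS.
rewrite rmorphN rmorph_sum; congr (- _).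
under eq_bigr do rewrite /= -HE.
under eq_bigl do rewrite lex1 andbT.
under [RHS]eq_bigl do rewrite lex1 andbT.
rewrite (sum_coarsenings_by_shape _ _ TS).
by apply: eq_bigr => b _; rewrite mulr_natr.
Qed.
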